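(* Let $\ell\ge 0$ be an integer and $n=2\ell+2$. Let $\mathfrak{c}=\mathfrak{so}(n)\ltimes\mathbb{C}^n$ be the common Lie algebra of $IO(n)=O(n)\ltimes\mathbb{C}^n$ and $ISO(n)=SO(n)\ltimes\mathbb{C}^n$. Let $J$ (resp. $Y(\mathfrak{c})$) be the algebra of polynomial functions on $\mathfrak{c}^*$ invariant under the coadjoint action of $IO(n)$ (resp. of $ISO(n)$). For $0\le k\le \ell$ let $\psi_k:\mathfrak{c}^*\to\mathbb{C}$ be the polynomial function $\psi_k(y,w^* )=-w^*B_{2k}(y)\,{}^tw^*$. Then $J=Y(\mathfrak{c})$ and $$J=\mathbb{C}[\psi_0,\dots,\psi_\ell].$$
   Context: The base field is $\mathbb{C}$. $\mathbb{C}^n$ is identified with column matrices and its dual with row matrices; ${}^tX$ denotes the transpose of $X$. $O(n)$, $SO(n)$ are the complex orthogonal and special orthogonal groups, and $\mathfrak{so}(n)$ is the Lie algebra of antisymmetric complex $n\times n$ matrices. For $x\in M_n(\mathbb{C})$ define $p_1(x),\dots,p_n(x)$ by $\det(tI_n-x)=t^n-p_1(x)t^{n-1}-\cdots-p_n(x)$, and set $B_0(x)=I_n$ and $B_k(x)=x^k-p_1(x)x^{k-1}-\cdots-p_k(x)I_n$ for $1\le k\le n-1$. The groups $IO(n)$ and $ISO(n)$ are semidirect products for the natural action, with law $(g,u)(g',u')=(gg',u+gu')$. The Lie algebra $\mathfrak{c}=\mathfrak{so}(n)\times\mathbb{C}^n$ has $[(x,0),(0,u)]=(0,xu)$, with $\mathbb{C}^n$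 an abelian ideal. The dual $\mathfrak{c}^*$ is identified with the set of pairs $(y,w^* )$, with $y\in\mathfrak{so}(n)$ and $w^*$ a row vector, through the pairing $\langle(y,w^* ),(x,u)\rangle=\operatorname{tr}(yx)+2w^*u$. (This is the pairing obtained by embedding $\mathfrak{c}$ into $\mathfrak{gl}(n)\ltimes(\mathbb{C}^n\oplus(\mathbb{C}^n)^* )$ via $(x,u)\mapsto(x,u,-{}^tu)$ and identifying $(y,w^* )$ with $(y,w^*,-{}^tw^* )$.) The coadjoint action is $\langle Ad^*(h)\lambda,X\rangle=\langle\lambda,Ad(h^{-1})X\rangle$. The symmetric algebra $S(\mathfrak{c})$ is identified with the algebra of polynomial functions on $\mathfrak{c}^*$. *)

(* Defs.v *)
From mathcomp Require Import all_boot all_order all_algebra.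
From mathcomp Require Import classical_sets reals.
From mathcomp Require Import complex mpoly.

Set Implicit Arguments.
Unset Strict Implicit.
Unset Printing Implicit Defensive.

Import GRing.Theory.
Local Open Scope ring_scope.
Local Open Scope classical_set_scope.

Definition orthogonal (K : fieldType) (n : nat) :=
  {g : 'M[K]_n | g^T *m g == 1%:M}.

Definition so (K : fieldType) (n : nat) := {x : 'M[K]_n | x^T == - x}.

Lemma orthogonalTg (K : fieldType) n (g : orthogonal K n) :
  (val g)^T *m val g = 1%:M.
Proof. exact/eqP/(valP g). Qed.

Lemma orthogonal_unit (K : fieldType) n (g : orthogonal K n) :
  val g \in unitmx.
Proof. by case: (mulmx1_unit (orthogonalTg g)). Qed.

Lemma orthogonalV (K : fieldType) n (g : orthogonal K n) :
  invmx (val g) = (val g)^T.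
Proof.
by rewrite -[RHS](mulmxK (orthogonal_unit g)) orthogonalTg mul1mx.
Qed.

Lemma orthogonalM_proof (K : fieldType) n (g h : orthogonal K n) :
  (val g *m val h)^T *m (val g *m val h) == 1%:M.
Proof.
by rewrite trmx_mul mulmxA -[_ *m _ *m val g]mulmxA orthogonalTg mulmx1
  orthogonalTg.
Qed.

Lemma orthogonalV_proof (K : fieldType) n (g : orthogonal K n) :
  (invmx (val g))^T *m invmx (val g) == 1%:M.
Proof. by rewrite {1}orthogonalV trmxK mulmxV ?orthogonal_unit. Qed.

Lemma soJ_proof (K : fieldType) n (g : orthogonal K n) (x : so K n) :
  (val g *m val x *m invmx (val g))^T == - (val g *m val x *m invmx (val g)).
Proof.
by rewrite orthogonalV !trmx_mul trmxK (eqP (valP x)) mulNmx mulmxN mulmxA.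
Qed.

Definition IO (K : fieldType) (n : nat) : Type := orthogonal K n * 'cV[K]_n.

Definition IO_mul (K : fieldType) (n : nat) (h k : IO K n) : IO K n :=
  (exist _ (val h.1 *m val k.1) (orthogonalM_proof h.1 k.1),
   h.2 + val h.1 *m k.2).

Definition IO_inv (K : fieldType) (n : nat) (h : IO K n) : IO K n :=
  (exist _ (invmx (val h.1)) (orthogonalV_proof h.1),
   - (invmx (val h.1) *m h.2)).

Definition ISO (K : fieldType) (n : nat) : set (IO K n) :=
  [set h | \det (val h.1) = 1].

Arguments ISO K n : clear implicits.

Definition lieC (K : fieldType) (n : nat) : Type := so K n * 'cV[K]_n.

Definition dualC (K : fieldType) (n : nat) : Type := so K n * 'rV[K]_n.

Definition pairing (K : fieldType) (n : nat) (lam : dualC K n) (X : lieC K n) :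
    K :=
  \tr (val lam.1 *m val X.1) + 2 * (lam.2 *m X.2) 0 0.

(* Conjugation by h in the affine matrix realization: see [Ad_affine]. *)
Definition Ad (K : fieldType) (n : nat) (h : IO K n) (X : lieC K n) :
    lieC K n :=
  (exist _ (val h.1 *m val X.1 *m invmx (val h.1)) (soJ_proof h.1 X.1),
   val h.1 *m X.2 - val h.1 *m val X.1 *m invmx (val h.1) *m h.2).

(* [is_coAd h lam mu] reads mu = Ad^*(h) lam; the pairing being nondegenerate,
   there is exactly one such mu, see [is_coAd_exists_unique]. *)
Definition is_coAd (K : fieldType) (n : nat) (h : IO K n)
    (lam mu : dualC K n) : Prop :=
  forall X : lieC K n, pairing mu X = pairing lam (Ad (IO_inv h) X).

(* Restrictions to c^* of the polynomials in all the entries of y and w^*. *)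
Definition polyfun (K : fieldType) (n : nat) : set (dualC K n -> K) :=
  [set f | exists p : {mpoly K[(n * n + n)%N]}, forall lam : dualC K n,
     f lam = p.@[fun i => row_mx (mxvec (val lam.1)) lam.2 0 i]].

Definition coAd_invariants (K : fieldType) (n : nat) (H : set (IO K n)) :
    set (dualC K n -> K) :=
  [set f | polyfun f /\
     forall h lam mu, H h -> is_coAd h lam mu -> f mu = f lam].

Definition J_alg (K : fieldType) (n : nat) : set (dualC K n -> K) :=
  coAd_invariants setT.

Definition Y_alg (K : fieldType) (n : nat) : set (dualC K n -> K) :=
  coAd_invariants (ISO K n).

Arguments J_alg K n : clear implicits.
Arguments Y_alg K n : clear implicits.

(* K[f_0, ..., f_(m-1)], the algebra of functions generated by the f_k. *)
Definition generated_alg (K : fieldType) (T : Type) (m : nat)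
    (f : 'I_m -> T -> K) : set (T -> K) :=
  [set F | exists P : {mpoly K[m]}, forall t, F t = P.@[fun k => f k t]].

(* det (t I_n - x) = t^n - p_1(x) t^(n-1) - ... - p_n(x), for 1 <= i <= n. *)
Definition p_ (K : fieldType) (n : nat) (i : nat) (x : 'M[K]_n) : K :=
  - (char_poly x)`_(n - i).

Definition B_ (K : fieldType) (n : nat) (k : nat) (x : 'M[K]_n) : 'M[K]_n :=
  x ^+ k - \sum_(1 <= i < k.+1) p_ i x *: x ^+ (k - i).

Definition psi (K : fieldType) (n : nat) (k : nat) (lam : dualC K n) : K :=
  - (lam.2 *m B_ (2 * k)%N (val lam.1) *m lam.2^T) 0 0.

Lemma char_poly_p_ (K : fieldType) n (x : 'M[K]_n) :
  char_poly x = 'X^n - \sum_(1 <= i < n.+1) p_ i x *: 'X^(n - i).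
Proof.
have szx := size_char_poly x.
rewrite -[LHS]coefK poly_def szx big_ord_recr /= addrC.
have := monicP (char_poly_monic x); rewrite lead_coefE szx /= => ->.
rewrite scale1r; congr (_ + _); rewrite -sumrN big_add1 /= big_mkord.
rewrite [RHS](reindex_inj rev_ord_inj) /=; apply: eq_bigr => i _.
by rewrite -subSn // subSS subKn ?(ltnW (ltn_ord i)) // /p_ subKn
  ?(ltnW (ltn_ord i)) // scaleNr opprK.
Qed.

Definition affine_group (K : fieldType) n (h : IO K n) : 'M[K]_(n + 1) :=
  block_mx (val h.1) h.2 0 1%:M.

Definition affine_algebra (K : fieldType) n (X : lieC K n) : 'M[K]_(n + 1) :=
  block_mx (val X.1) X.2 0 0.

Lemma affine_groupM (K : fieldType) n (h k : IO K n) :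
  affine_group (IO_mul h k) = affine_group h *m affine_group k.
Proof.
by rewrite /affine_group mulmx_block /= !mul0mx !mulmx0 !mulmx1 !addr0 add0r
  addrC.
Qed.

Lemma affine_groupV (K : fieldType) n (h : IO K n) :
  affine_group h *m affine_group (IO_inv h) = 1%:M.
Proof.
rewrite /affine_group mulmx_block /= !mul0mx !mulmx0 !mulmx1 !addr0 add0r.
by rewrite mulmxV ?orthogonal_unit // mulmxN mulmxA mulmxV ?orthogonal_unit //
  mul1mx addNr -scalar_mx_block.
Qed.

Lemma Ad_affine (K : fieldType) n (h : IO K n) (X : lieC K n) :
  affine_algebra (Ad h X)
  = affine_group h *m affine_algebra X *m affine_group (IO_inv h).
Proof.
rewrite /affine_group /affine_algebra !mulmx_block /=.
rewrite ?(mul0mx, mulmx0, mulmx1, addr0, add0r).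
by rewrite mulmxN mulmxA addrC.
Qed.

Lemma pairing_nondegenerate (K : numFieldType) n (a b : dualC K n) :
  (forall X, pairing a X = pairing b X) -> a = b.
Proof.
have nz2 : (2 : K) != 0 by rewrite Num.Theory.pnatr_eq0.
case: a b => [y w] [z t] eq_ab; congr (_, _); last first.
  apply/rowP => j.
  have z0 : (0 : 'M[K]_n)^T == - 0 by rewrite trmx0 oppr0.
  have := eq_ab (exist _ 0 z0 : so K n, delta_mx j 0).
  rewrite /pairing /= !mulmx0 !mxtrace0 !add0r => /(mulfI nz2).
  by rewrite -!colE !mxE.
apply: val_inj; apply/matrixP => i j.
pose x : 'M[K]_n := delta_mx j i - delta_mx i j.
have hx : x^T == - x by rewrite /x linearB /= !trmx_delta opprB.
have trx (s : so K n) : \tr (val s *m x) = 2 * val s i j.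
  have tr_delta k l : \tr (val s *m delta_mx k l) = val s l k.
    rewrite -(mul_delta_mx (0 : 'I_1)) mulmxA mxtrace_mulC trace_mx11.
    by rewrite -colE -rowE !mxE.
  rewrite /x mulmxBr linearB /= !tr_delta.
  have -> : val s j i = - val s i j.
    by have /eqP/matrixP/(_ i j) := valP s; rewrite !mxE.
  by rewrite opprK mulr2n mulrDl mul1r.
have := eq_ab (exist _ x hx : so K n, 0).
by rewrite /pairing /= !mulmx0 !mxE !mulr0 !addr0 !trx => /(mulfI nz2).
Qed.

Lemma is_coAd_exists_unique (K : numFieldType) n (h : IO K n)
    (lam : dualC K n) :
  exists! mu, is_coAd h lam mu.
Proof.
case: h => g u; case: lam => y w.
pose A := u *m w *m invmx (val g).
have hm : (val g *m val y *m invmx (val g) + (A - A^T))^T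
   == - (val g *m val y *m invmx (val g) + (A - A^T)).
  by rewrite linearD /= (eqP (soJ_proof g y)) [(A - _)^T]linearB /= trmxK
    opprD opprB.
pose mu0 : dualC K n :=
  (exist (fun y : 'M_n => y^T == - y) _ hm, w *m invmx (val g)).
suff key : is_coAd (g, u) (y, w) mu0.
  exists mu0; split=> // mu H; apply: pairing_nondegenerate => X.
  by rewrite key H.
move=> [x v]; rewrite /pairing /=.
rewrite invmxK !mulmxN opprK !mulmxA mulmxDl linearD /=.
have -> : \tr (val g *m val y *m invmx (val g) *m val x)
  = \tr (val y *m invmx (val g) *m val x *m val g).
  by rewrite -!mulmxA mxtrace_mulC !mulmxA.
rewrite -addrA; congr (_ + _).
have trT : \tr (A^T *m val x) = - \tr (A *m val x).
  by rewrite -mxtrace_tr trmx_mul trmxK (eqP (valP x)) mulNmx linearN /=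
    mxtrace_mulC.
rewrite mulmxBl linearB /= trT opprK -mulr2n -[\tr (A *m _) *+ 2]mulr_natl
  -mulrDr.
congr (_ * _); rewrite mulmxDr !mulmxA.
rewrite mulmxK ?orthogonal_unit // [RHS]mxE addrC; congr (_ + _).
by rewrite /A -!mulmxA mxtrace_mulC trace_mx11 !mulmxA.
Qed.

(* Main.v *)
Require Import Defs.
From mathcomp Require Import all_boot all_order all_algebra separable.
From mathcomp Require Import classical_sets reals.
From mathcomp Require Import complex mpoly zify.

(** Invariance and generation both go through the polynomial
    H(y,w) = det [[t - y, w^T], [w, 0]] = - w adj(t - y) w^T, whose coefficient of
    t^(n-1-2k) is psi_k and whose other coefficients vanish for y antisymmetric.
    Row and column operations show that H is constant on coadjoint orbits.

    For the converse, fix isotropic rows e_i, f_i with e_i f_j^T = delta_ij, let y0 be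
    antisymmetric with e_i y0 = i e_i and f_i y0 = - i f_i, and put
    w(q) = sum_i (e_i + q_i f_i / 2). On this affine section psi is an invertible linear
    function of q, by a Vandermonde argument, so an invariant restricted to the section is
    a polynomial in psi. It remains to see that a generic point is ISO(n)-conjugate to the
    point of the section with the same psi. If w w^T <> 0, a translation achieves w y = 0;
    then each root r of H has an eigenvector x of y with x w^T = 0, and if the roots are
    distinct these can be scaled so that x_r x_s^T is 1 if r + s = 0 and 0 otherwise.
    Matching the frames of two points with the same H yields the conjugating orthogonal
    matrix. Its determinant is made 1 by changing the sign of the odd number of
    eigenvectors. Genericity is the nonvanishing of a resultant along a line. *)

Set Implicit Arguments.
Unset Strict Implicit.
Unset Printing Implicit Defensive.

Import Order.TTheory GRing.Theory Num.Theory.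
Local Open Scope ring_scope.

(** * The bordered characteristic polynomial *)

(** The ring is arbitrary so that one determinant serves over the base field, over polynomials in
    the entries and along lines, compared by specialisation. *)
Definition bordered (A : comNzRingType) n (s : A) (y : 'M[A]_n) (w : 'rV[A]_n) :
    'M[A]_(n + 1) :=
  block_mx (s%:M - y) w^T w 0.

Definition bordered_char (A : comNzRingType) n (y : 'M[A]_n) (w : 'rV[A]_n) :
    {poly A} :=
  \det (bordered 'X (map_mx polyC y) (map_mx polyC w)).

Lemma map_bordered (A B : comNzRingType) (f : {rmorphism A -> B}) n s
    (y : 'M[A]_n) (w : 'rV[A]_n) :
  map_mx f (bordered s y w) = bordered (f s) (map_mx f y) (map_mx f w).
Proof. by rewrite map_block_mx map_mxB map_scalar_mx -matrix.map_trmx map_mx0. Qed.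

Lemma horner_bordered_char (A : comNzRingType) n (y : 'M[A]_n) (w : 'rV[A]_n) s :
  (bordered_char y w).[s] = \det (bordered s y w).
Proof.
rewrite -[LHS]/(horner_eval s _) -det_map_mx map_bordered /= horner_evalE hornerX.
by congr (\det (bordered s _ _)); apply/matrixP=> i j; rewrite !mxE horner_evalE hornerC.
Qed.

Lemma map_bordered_char (A B : comNzRingType) (f : {rmorphism A -> B}) n
    (y : 'M[A]_n) (w : 'rV[A]_n) :
  map_poly f (bordered_char y w) = bordered_char (map_mx f y) (map_mx f w).
Proof.
rewrite -[LHS]/(map_poly f _) -det_map_mx map_bordered /= map_polyX.
by congr (\det (bordered 'X _ _)); apply/matrixP=> i j; rewrite !mxE map_polyC.
Qed.

Lemma poly_horner_inj (K : numDomainType) (p q : {poly K}) :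
  (forall s, p.[s] = q.[s]) -> p = q.
Proof.
move=> pq; apply/eqP; rewrite -subr_eq0; apply/eqP.
apply: (@roots_geq_poly_eq0 _ _ [seq i%:R | i <- iota 0 (size (p - q))]).
- by apply/allP=> _ /mapP[i _ ->]; rewrite rootE hornerD hornerN pq subrr.
- by rewrite map_inj_uniq ?iota_uniq // => i j /eqP; rewrite eqr_nat => /eqP.
- by rewrite size_map size_iota.
Qed.

Lemma poly_generic_eq0 (K : numDomainType) (p d : {poly K}) :
  d != 0 -> (forall s, d.[s] != 0 -> p.[s] = 0) -> p = 0.
Proof.
move=> d0 dp; apply/eqP; have /eqP : p * d = 0.
  apply: poly_horner_inj => s; rewrite hornerM horner0.
  by have [->|/dp->] := eqVneq d.[s] 0; rewrite ?mulr0 ?mul0r.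
by rewrite mulf_eq0 (negPf d0) orbF.
Qed.

(** * The matrices [B_ k y] and the adjugate of s - y *)

Lemma B_0 (K : fieldType) n (y : 'M[K]_n) : B_ 0 y = 1.
Proof. by rewrite /B_ expr0 big_geq // subr0. Qed.

(** Horner's recursion for truncations of the characteristic polynomial; it makes the sum in
    [mul_resolvent] telescope. *)
Lemma B_S (K : fieldType) n k (y : 'M[K]_n) :
  B_ k.+1 y = y *m B_ k y - (p_ k.+1 y)%:M.
Proof.
rewrite /B_ exprS big_nat_recr //= subnn expr0 opprD addrA mulmxBr scalemx1.
congr (_ - _ - _); rewrite mulmx_sumr !big_nat; apply: eq_bigr => i /andP[_ lti].
by rewrite subSn // exprS -scalemxAr.
Qed.

(** Cayley-Hamilton: the n-th truncation is the whole characteristic polynomial. *)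
Lemma B_char_eq0 (K : fieldType) n (y : 'M[K]_n) : B_ n y = 0.
Proof.
case: n y => [|n] y; first by apply/matrixP=> -[].
rewrite -[RHS](Cayley_Hamilton y) char_poly_p_ rmorphB /= rmorphXn /= horner_mx_X.
rewrite /B_ rmorph_sum; congr (_ - _); apply: eq_bigr => i _ /=.
by rewrite horner_mxZ rmorphXn /= horner_mx_X.
Qed.

(* The adjugate of [s - y], expanded in powers of [s]. *)
Definition resolvent (K : fieldType) n (y : 'M[K]_n) (s : K) : 'M[K]_n :=
  \sum_(k < n) s ^+ (n.-1 - k) *: B_ k y.

(** The differences F k - F k.+1 collapse to s^n, because F n = 0, and the scalars left over by
    [B_S] supply the lower terms of the characteristic polynomial. *)
Lemma mul_resolvent (K : fieldType) n (y : 'M[K]_n) s :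
  (s%:M - y) *m resolvent y s = (char_poly y).[s]%:M.
Proof.
rewrite mulmxBl mul_scalar_mx /resolvent scaler_sumr mulmx_sumr.
pose F k : 'M[K]_n := s ^+ (n - k) *: B_ k y.
have step (k : 'I_n) : s *: (s ^+ (n.-1 - k) *: B_ k y)
    - y *m (s ^+ (n.-1 - k) *: B_ k y)
    = (F k - F k.+1) - (s ^+ (n.-1 - k) * p_ k.+1 y)%:M.
  have -> : (n.-1 - k = n - k.+1)%N by rewrite -subn1 -subnDA add1n.
  rewrite /F B_S scalerA -exprS -subSn ?ltn_ord // subSS -scalemxAr.
  rewrite [_ *: (_ *m _ - _)]scalerBr opprB scale_scalar_mx.
  by rewrite addrA addrAC addrK.
rewrite -sumrB (eq_bigr _ (fun k _ => step k)) sumrB.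
rewrite -(big_mkord xpredT (fun k => F k - F k.+1)).
rewrite (telescope_sumr_eq (fun k => - F k)) // => [|k _]; last by rewrite opprK addrC.
rewrite /F B_char_eq0 B_0 scaler0 oppr0 add0r opprK subn0.
rewrite char_poly_p_ hornerD hornerN hornerXn horner_sum raddfB /= -scalemx1.
congr (_ - _); rewrite raddf_sum /= big_add1 /= big_mkord; apply: eq_bigr => k _.
by rewrite hornerZ hornerXn mulrC -subn1 -subnDA add1n.
Qed.

Lemma det_char (K : fieldType) n (y : 'M[K]_n) s :
  \det (s%:M - y) = (char_poly y).[s].
Proof.
rewrite /char_poly -[RHS]/(horner_eval s _) -det_map_mx; congr (\det _).
apply/matrixP=> i j; rewrite !mxE /=.
by rewrite /horner_eval hornerD hornerN hornerC hornerMn hornerX.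
Qed.

(** A block triangular factor on the right clears w^T from the last column, leaving det(s - y) times
    - w R w^T with R the [resolvent]. That factor also has determinant det(s - y), which cancels off
    the roots of the characteristic polynomial; this suffices for a polynomial identity. *)
Lemma bordered_charE (K : numFieldType) n (y : 'M[K]_n) (w : 'rV[K]_n) :
  bordered_char y w = \poly_(j < n) (- (w *m B_ (n.-1 - j) y *m w^T) 0 0).
Proof.
have char0 : char_poly y != 0 by rewrite monic_neq0 ?char_poly_monic.
apply: subr0_eq; apply: (poly_generic_eq0 char0) => s chars.
apply: (mulIf chars); rewrite mul0r hornerD hornerN mulrBl.
rewrite horner_bordered_char.
have := det_mulmx (bordered s y w)
  (block_mx 1%:M (- (resolvent y s *m w^T)) 0 (char_poly y).[s]%:M).
rewrite det_ublock det1 mul1r det_scalar1 => <-.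
rewrite mulmx_block !mulmx1 !mulmx0 !mul0mx !addr0 mulmxN mulmxA mul_resolvent.
rewrite mul_scalar_mx mul_mx_scalar addNr det_lblock det_char det_mx11 mulrC -mulrBl.
rewrite [X in X - _](_ : _ = (\poly_(j < n) (- (w *m B_ (n.-1 - j) y *m w^T) 0 0)).[s]).
  by rewrite subrr mul0r.
rewrite horner_poly mulmxN mxE /resolvent mulmxA mulmx_sumr mulmx_suml summxE -sumrN.
rewrite [RHS](reindex_inj rev_ord_inj); apply: eq_bigr => k _ /=.
have kn := ltn_ord k; have -> : (n.-1 - (n - k.+1) = k)%N by lia.
have -> : (n - k.+1 = n.-1 - k)%N by lia.
by rewrite -scalemxAr -scalemxAl mxE mulNr mulrC.
Qed.

(** * The coadjoint action *)

Lemma so_tr (K : fieldType) n (y : so K n) : (val y)^T = - val y.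
Proof. exact/eqP/(valP y). Qed.

Lemma coAd_proof (K : fieldType) n (g y : 'M[K]_n) (a : 'M[K]_n) :
  y^T == - y -> (g *m y *m g^T + (a - a^T))^T == - (g *m y *m g^T + (a - a^T)).
Proof.
move=> /eqP yT; rewrite linearD /= [(a - _)^T]linearB /= !trmx_mul !trmxK yT.
by rewrite mulNmx mulmxN mulmxA opprD opprB.
Qed.

Definition coAd (K : fieldType) n (h : IO K n) (lam : dualC K n) : dualC K n :=
  (exist (fun x : 'M_n => x^T == - x) _
     (coAd_proof (val h.1) (h.2 *m (lam.2 *m (val h.1)^T)) (valP lam.1)),
   lam.2 *m (val h.1)^T).

(** With a = u w g^T, antisymmetry of x gives tr((a - a^T) x) = 2 tr(a x), which matches the factor
    2 in [pairing]. *)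
Lemma coAdP (K : numFieldType) n (h : IO K n) (lam : dualC K n) :
  is_coAd h lam (coAd h lam).
Proof.
case: h lam => [g u] [y w] [x v]; rewrite /pairing /= invmxK orthogonalV.
set G := val g; set Y := val y; set X := val x; set a := u *m _.
have -> : \tr (Y *m (G^T *m X *m G)) = \tr (G *m Y *m G^T *m X).
  by rewrite mulmxA mxtrace_mulC !mulmxA.
have aX : \tr (a *m X) = (w *m G^T *m X *m u) 0 0.
  by rewrite /a -mulmxA mxtrace_mulC trace_mx11.
have aTX : \tr (a^T *m X) = - \tr (a *m X).
  rewrite -mxtrace_tr trmx_mul trmxK so_tr mulNmx linearN /=.
  by rewrite mxtrace_mulC.
rewrite mulmxDl mulmxBl !linearD /= linearN /= aTX opprK aX -addrA; congr (_ + _).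
have -> : G^T *m X *m G *m - (G^T *m u) = - (G^T *m X *m u).
  by rewrite mulmxN -!mulmxA [G *m _]mulmxA mulmx1C ?mul1mx // orthogonalTg.
rewrite opprK [in RHS]mxE !mulmxA mulrDr addrC; congr (_ + _).
by rewrite mulr_natl mulr2n.
Qed.

Lemma is_coAdE (K : numFieldType) n (h : IO K n) (lam mu : dualC K n) :
  is_coAd h lam mu -> mu = coAd h lam.
Proof.
by move=> hmu; apply: pairing_nondegenerate => X; rewrite hmu -coAdP.
Qed.

Lemma orthogonal_det_sqr (K : fieldType) n (g : Defs.orthogonal K n) :
  \det (val g) * \det (val g) = 1.
Proof. by rewrite -{1}det_tr -det_mulmx orthogonalTg det1. Qed.

(** Block triangular factors built from g, -u on the left and g^T, u^T on the right carry one
    bordered matrix to the other. Their determinants multiply to (det g)^2 = 1, so reflections are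
    covered too. *)
Lemma det_bordered_coAd (K : fieldType) n (h : IO K n) (lam : dualC K n) s :
  \det (bordered s (val (coAd h lam).1) (coAd h lam).2)
  = \det (bordered s (val lam.1) lam.2).
Proof.
case: h lam => [g u] [y w] /=; set G := val g; set Y := val y.
have GG : G *m G^T = 1%:M by apply: mulmx1C; exact: orthogonalTg.
have := det_mulmx (block_mx G (- u) 0 1%:M *m bordered s Y w)
  (block_mx G^T 0 u^T 1%:M).
rewrite [in X in _ = X]det_mulmx det_ublock det_lblock det_tr !det1 !mulr1 mulrAC.
rewrite orthogonal_det_sqr mul1r => <-; congr (\det _).
rewrite /bordered !mulmx_block.
rewrite ?(mulmx0, mul0mx, mulmx1, mul1mx, addr0, add0r) !trmx_mul !trmxK -/G -/Y.
congr block_mx; rewrite mulmxDl mulmxBr mulmxBl mul_mx_scalar -scalemxAl GG scalemx1.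
by rewrite !mulNmx opprD opprB !mulmxA -!addrA [- _ + G *m _ *m _]addrC.
Qed.

Lemma bordered_char_coAd (K : numFieldType) n (h : IO K n) (lam : dualC K n) :
  bordered_char (val (coAd h lam).1) (coAd h lam).2 = bordered_char (val lam.1) lam.2.
Proof.
by apply: poly_horner_inj => s; rewrite !horner_bordered_char det_bordered_coAd.
Qed.

(** * The psi_k as coefficients: polynomiality, invariance, parity *)

Lemma psiE (K : numFieldType) n k (lam : dualC K n) : (2 * k < n)%N ->
  psi k lam = (bordered_char (val lam.1) lam.2)`_(n.-1 - 2 * k).
Proof.
move=> kn; rewrite bordered_charE coef_poly ifT; last lia.
by rewrite /psi; do 3!f_equal; congr (_ *m B_ _ _); lia.
Qed.

(** Indeterminates in the coordinate order of [polyfun], so that coefficients of the generic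
    bordered polynomial represent the psi_k. *)
Definition generic_y (K : fieldType) n : 'M[{mpoly K[(n * n + n)%N]}]_n :=
  \matrix_(i, j) 'X_(lshift n (mxvec_index i j)).

Definition generic_w (K : fieldType) n : 'rV[{mpoly K[(n * n + n)%N]}]_n :=
  \row_j 'X_(rshift (n * n) j).

Lemma meval_bordered_char (K : fieldType) n (y : 'M[K]_n) (w : 'rV[K]_n) :
  map_poly (meval (fun i => row_mx (mxvec y) w 0 i))
    (bordered_char (generic_y K n) (generic_w K n)) = bordered_char y w.
Proof.
rewrite map_bordered_char; congr bordered_char; apply/matrixP=> i j.
  by rewrite !mxE /= mevalXU row_mxEl mxvecE.
by rewrite !mxE /= mevalXU row_mxEr ord1.
Qed.

Lemma generated_sub_J (K : numFieldType) n l : (2 * l < n)%N ->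
  (generated_alg (fun k : 'I_l.+1 => @psi K n k) `<=` J_alg K n)%classic.
Proof.
move=> ln F [P FP]; have kn (k : 'I_l.+1) : (2 * k < n)%N.
  by have := ltn_ord k; lia.
split=> [|h lam mu _ /is_coAdE->]; last first.
  by rewrite !FP; apply: meval_eq => k; rewrite !psiE // bordered_char_coAd.
exists (P \mPo [tuple (bordered_char (generic_y K n) (generic_w K n))`_(n.-1 - 2 * k)
                | k < l.+1]) => lam.
rewrite FP comp_mpoly_meval; apply: meval_eq => k.
by rewrite tnth_mktuple psiE // -coef_map meval_bordered_char.
Qed.

(** The transposed matrix at - s is the matrix at s with its first n rows and its last column
    negated; for even n the total sign is -1. *)
Lemma bordered_charN (K : fieldType) n (y : 'M[K]_n) (w : 'rV[K]_n) s :
  ~~ odd n -> y^T = - y -> (bordered_char y w).[- s] = - (bordered_char y w).[s].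
Proof.
move=> en yT; rewrite !horner_bordered_char -det_tr.
have -> : (bordered (- s) y w)^T
    = block_mx (-1)%:M 0 0 1%:M *m bordered s y w *m block_mx 1%:M 0 0 (-1)%:M.
  rewrite /bordered tr_block_mx !mulmx_block trmx0 trmxK linearB /= yT tr_scalar_mx.
  rewrite ?(mulmx0, mul0mx, mulmx1, mul1mx, addr0, add0r).
  by rewrite !mul_scalar_mx !scaleN1r mul_mx_scalar scaleN1r !opprK raddfN /= opprB addrC.
rewrite !det_mulmx !det_ublock !det_scalar !expr1 !expr1n -signr_odd (negPf en).
by rewrite expr0 !mulr1 !mul1r mulrN1.
Qed.

Lemma odd_poly_coef (K : numDomainType) (p : {poly K}) j :
  (forall s, p.[- s] = - p.[s]) -> ~~ odd j -> p`_j = 0.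
Proof.
move=> podd ej; have pE : \poly_(i < size p) ((-1) ^+ i * p`_i) = - p.
  apply: poly_horner_inj => s; rewrite hornerN -podd horner_poly horner_coef.
  by apply: eq_bigr => i _; rewrite [in RHS]exprNn mulrCA mulrA mulrAC.
have := congr1 (fun q : {poly K} => q`_j) pE.
rewrite /= coef_poly coefN -signr_odd (negPf ej) mul1r.
case: ltnP => [_|sj _]; last exact: nth_default.
by move/eqP; rewrite -addr_eq0 -mulr2n mulrn_eq0 /= => /eqP.
Qed.

(** For n = 2l + 2 the exponents n - 1 - 2k with k <= l are exactly the odd numbers below n, and the
    even coefficients vanish by parity. *)
Lemma bordered_char_psi (K : numFieldType) n l (lam : dualC K n) :
  n = (2 * l + 2)%N ->
  bordered_char (val lam.1) lam.2 = \sum_(k < l.+1) psi k lam *: 'X^(n.-1 - 2 * k).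
Proof.
move=> nE; have en : ~~ odd n by rewrite nE; lia.
apply/polyP => j; rewrite [RHS]coef_sum.
under [RHS]eq_bigr => k _ do rewrite coefZ coefXn.
have [nj|jn] := leqP n j.
  rewrite bordered_charE coef_poly ltnNge nj big1 // => k _.
  by rewrite (_ : _ == _ = false) ?mulr0 //; have := ltn_ord k; lia.
have [oj|ej] := boolP (odd j); last first.
  rewrite big1 => [|k _]; last by rewrite (_ : _ == _ = false) ?mulr0 //; have := ltn_ord k; lia.
  by apply: odd_poly_coef ej => s; apply: bordered_charN en (so_tr _).
have kl : ((n.-1 - j)./2 < l.+1)%N by lia.
rewrite (bigD1 (Ordinal kl)) //= big1 ?addr0 => [|k kj]; last first.
  rewrite (_ : _ == _ = false) ?mulr0 //; apply/negbTE; apply: contraNneq kj => jE.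
  by apply/eqP/val_inj => /=; have := ltn_ord k; lia.
have jE : j = (n.-1 - 2 * (n.-1 - j)./2)%N by lia.
by rewrite -jE eqxx mulr1 psiE -?jE //; lia.
Qed.

(** * Eigenvectors attached to the roots *)

(** Applying powers of y to a relation v X = 0 weights its terms by d_i^k; inverting the Vandermonde
    matrix isolates each term. *)
Lemma eigen_row_free (K : fieldType) m n (X : 'M[K]_(m, n)) y (d : 'I_m -> K) :
  injective d -> X *m y = diag_mx (\row_i d i) *m X -> (forall i, row i X != 0) ->
  row_free X.
Proof.
move=> dinj Xy X0; apply: inj_row_free => v vX.
have vdX k : (\row_i (v 0 i * d i ^+ k)) *m X = 0.
  elim: k => [|k IH].
    by rewrite -[RHS]vX; congr (_ *m _); apply/rowP=> i; rewrite mxE mulr1.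
  rewrite (_ : \row__ _ = (\row_i (v 0 i * d i ^+ k)) *m diag_mx (\row_i d i)).
    by rewrite -mulmxA -Xy mulmxA IH mul0mx.
  by apply/rowP=> i; rewrite mul_mx_diag !mxE exprSr mulrA.
pose V := Vandermonde m (\row_i d i).
have uV : V \in unitmx.
  rewrite unitmxE unitfE det_Vandermonde; apply/prodf_neq0 => i _.
  apply/prodf_neq0 => j ij; rewrite !mxE subr_eq0.
  by apply: contraTneq ij => /dinj ->; rewrite ltnn.
have dvX : diag_mx v *m X = 0.
  apply: (can_inj (mulKmx uV)); rewrite mulmx0 mulmxA; apply/row_matrixP=> k.
  rewrite row_mul row0 -[RHS](vdX k); congr (_ *m _).
  by apply/rowP=> i; rewrite mul_mx_diag !mxE mulrC.
apply/rowP=> i; rewrite mxE; have /rowP Xi := congr1 (row i) dvX.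
have /rV0Pn[j Xij] := X0 i; have := Xi j; rewrite row0 mul_diag_mx !mxE.
by rewrite !mxE in Xij; move/eqP; rewrite mulf_eq0 (negPf Xij) orbF => /eqP.
Qed.

(** A left kernel vector (x, c) satisfies x (r - y) + c w = 0 and x w^T = 0. Multiplying by w^T,
    with y w^T = 0, gives c w w^T = 0, hence c = 0. *)
Lemma bordered_root_eigen (K : fieldType) n (y : 'M[K]_n) (w : 'rV[K]_n) r :
  y^T = - y -> w *m y = 0 -> (w *m w^T) 0 0 != 0 -> root (bordered_char y w) r ->
  exists x : 'rV_n, [/\ x != 0, x *m y = r *: x & x *m w^T = 0].
Proof.
move=> yT wy q0; rewrite /root horner_bordered_char => /det0P[v v0].
rewrite -[v]hsubmxK mul_row_block mulmx0 addr0 -[0]row_mx0 => /eq_row_mx[].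
set x := lsubmx v; set c := rsubmx v; rewrite mulmxBr mul_mx_scalar => xy xw.
have ywT : y *m w^T = 0.
  by apply: (can_inj (@trmxK _ _ _)); rewrite trmx_mul trmxK yT mulmxN wy oppr0 trmx0.
have c0 : c = 0.
  have := congr1 (mulmx^~ w^T) xy; rewrite mul0mx mulmxDl mulmxBl -scalemxAl xw scaler0.
  rewrite -mulmxA ywT mulmx0 subrr add0r [c]mx11_scalar mul_scalar_mx -scalemxAl.
  move/matrixP/(_ 0 0); rewrite [LHS]mxE [RHS]mxE => /eqP; rewrite mulf_eq0 (negPf q0) orbF.
  by move=> /eqP ->; rewrite raddf0.
exists x; split=> //.
  by apply: contraNneq v0 => x0; rewrite -[v]hsubmxK -/x -/c x0 c0 row_mx0.
by move: xy; rewrite c0 mul0mx addr0 => /eqP; rewrite subr_eq0 => /eqP.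
Qed.

Lemma col_mx_free (K : fieldType) m n (w : 'rV[K]_n) (X : 'M[K]_(m, n)) :
  (w *m w^T) 0 0 != 0 -> X *m w^T = 0 -> row_free X -> row_free (col_mx w X).
Proof.
move=> q0 Xw fX; apply: inj_row_free => v; rewrite -[v]hsubmxK mul_row_col.
set a := lsubmx v; set b := rsubmx v => abX.
have a0 : a = 0.
  have := congr1 (mulmx^~ w^T) abX; rewrite mul0mx mulmxDl -!mulmxA Xw mulmx0 addr0.
  rewrite [a]mx11_scalar mul_scalar_mx.
  move/matrixP/(_ 0 0); rewrite [LHS]mxE [RHS]mxE => /eqP; rewrite mulf_eq0 (negPf q0) orbF.
  by move=> /eqP ->; rewrite raddf0.
move: abX; rewrite a0 mul0mx add0r => /eqP; rewrite mulmx_free_eq0 // => /eqP->.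
by rewrite row_mx0.
Qed.

(** * Eigenvector frames and orbits *)

(** The Gram matrix of a normalised eigenvector frame. It depends on the eigenvalues alone, which
    allows the frames of two points to be matched. *)
Definition opposite_gram (K : fieldType) m (d : 'I_m -> K) : 'M[K]_m :=
  \matrix_(i, j) (d i + d j == 0)%:R.

Lemma eigen_normal_form (K : numClosedFieldType) m n (y : 'M[K]_n) (w : 'rV[K]_n)
    (d : 'I_m -> K) :
  n = m.+1 -> y^T = - y -> w *m y = 0 -> (w *m w^T) 0 0 != 0 ->
  injective d -> (forall i, root (bordered_char y w) (d i)) ->
  exists X : 'M_(m, n), [/\ X *m y = diag_mx (\row_i d i) *m X, X *m w^T = 0,
    row_free X & X *m X^T = opposite_gram d].
Proof.
move=> nE yT wy q0 dinj droot.
have /fin_all_exists[x xP] := fun i => bordered_root_eigen yT wy q0 (droot i).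
pose X := \matrix_i x i.
have rX i : row i X = x i by rewrite rowK.
have Xy : X *m y = diag_mx (\row_i d i) *m X.
  apply/row_matrixP=> i; rewrite row_mul rX; have [_ -> _] := xP i.
  by apply/rowP=> j; rewrite mul_diag_mx !mxE.
have Xw : X *m w^T = 0.
  by apply/row_matrixP=> i; rewrite row_mul rX row0; have [_ _ ->] := xP i.
have fX : row_free X.
  by apply: eigen_row_free dinj Xy _ => i; rewrite rX; have [] := xP i.
have fP : row_free (col_mx w X)^T.
  by have := col_mx_free q0 Xw fX; rewrite /row_free mxrank_tr => /eqP ->; rewrite nE.
have [S defS] : exists S, S = X *m X^T by exists (X *m X^T).
have ST i j : S i j = S j i.
  have ST : S^T = S by rewrite defS trmx_mul trmxK.
  by rewrite -{1}ST mxE.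
(* Antisymmetry of y makes S anticommute with diag(d). *)
have S_opp i j : S i j != 0 -> d j = - d i.
  apply: contraNeq => dij; have /matrixP/(_ i j) :
      diag_mx (\row_i d i) *m S = - (S *m diag_mx (\row_i d i)).
    rewrite defS mulmxA -Xy -!mulmxA -mulmxN; congr (_ *m _).
    by rewrite -[y]opprK -yT mulNmx -trmx_mul Xy trmx_mul tr_diag_mx.
  rewrite mul_diag_mx mul_mx_diag !mxE => /eqP; rewrite -addr_eq0 [S i j * _]mulrC -mulrDl.
  by rewrite mulf_eq0 addr_eq0 eq_sym eqr_oppLR (negPf dij).
(* Otherwise x_i is orthogonal to the basis formed by w and all the x_j. *)
have S_ex i : exists j, S i j != 0.
  apply/existsP; apply: contraT; rewrite negb_exists => /forallP Si0.
  have [/negP[]] := xP i; rewrite -rX -(mulmx_free_eq0 _ fP) tr_col_mx mul_mx_row.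
  rewrite -!row_mul Xw row0 -defS [row i _](_ : _ = 0) ?row_mx0 //.
  by apply/rowP=> j; rewrite 2!mxE; apply/eqP/negPn/Si0.
(* Row i of S has a single nonzero entry, so the row sum names it without choosing the partner j. By
   symmetry partners share this value, and scaling both by the inverse of its square root makes the
   entry 1. *)
pose s i := \sum_j S i j.
have sE i j : S i j != 0 -> s i = S i j.
  move=> Sij; rewrite /s (bigD1 j) //= big1 ?addr0 // => k kj.
  apply: contraNeq kj => /S_opp dk; apply/eqP/dinj.
  by rewrite dk (S_opp i j).
have s0 i : s i != 0 by have [j Sij] := S_ex i; rewrite (sE _ _ Sij).
pose D := diag_mx (\row_i (sqrtC (s i))^-1).
have uD : D \in unitmx.
  rewrite unitmxE det_diag unitfE; apply/prodf_neq0 => i _.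
  by rewrite mxE invr_eq0 sqrtC_eq0.
exists (D *m X); split.
- by rewrite -mulmxA Xy !mulmxA; congr (_ *m _); rewrite diag_mxC.
- by rewrite -mulmxA Xw mulmx0.
- apply: inj_row_free => v /eqP; rewrite mulmxA mulmx_free_eq0 // => /eqP.
  by move/(canRL (mulmxK uD)); rewrite mul0mx.
rewrite trmx_mul tr_diag_mx mulmxA -[D *m X *m _]mulmxA -defS.
apply/matrixP=> i j; rewrite mul_mx_diag mxE mul_diag_mx !mxE.
have [Sij|Sij] := eqVneq (S i j) 0; last first.
  have -> : s j = S i j by rewrite (sE j i) [S j i]ST.
  rewrite (sE _ _ Sij) (S_opp _ _ Sij) subrr eqxx.
  by rewrite mulrAC -invfM -expr2 sqrtCK mulVf.
rewrite Sij mulr0 mul0r; have [/eqP dij|] //= := eqP.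
have [k Sik] := S_ex i; move: dij; rewrite addrC addr_eq0 -(S_opp _ _ Sik) => /eqP/dinj jk.
by rewrite -jk Sij eqxx in Sik.
Qed.

(** The matrix g = P2^-1 P1 is orthogonal because the two Gram matrices agree. *)
Lemma orthogonal_conj (K : fieldType) n (P1 P2 D y1 y2 : 'M[K]_n) :
  P1 \in unitmx -> P2 \in unitmx -> P1 *m P1^T = P2 *m P2^T ->
  P1 *m y1 = D *m P1 -> P2 *m y2 = D *m P2 ->
  exists g : Defs.orthogonal K n,
    [/\ val g *m y1 *m (val g)^T = y2, P1 *m (val g)^T = P2
      & \det P1 = \det P2 -> \det (val g) = 1].
Proof.
move=> u1 u2 gram Py1 Py2.
have [g gE] : exists g, g = invmx P2 *m P1 by exists (invmx P2 *m P1).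
have ggT : g *m g^T = 1%:M.
  rewrite gE trmx_mul -mulmxA (mulmxA P1) gram trmx_inv mulmxA mulKmx //.
  by rewrite mulmxV // unitmx_tr.
have gTg : g^T *m g == 1%:M by apply/eqP/mulmx1C.
have gP : P2 *m g = P1 by rewrite gE mulKVmx.
have Pg : P1 *m g^T = P2 by rewrite -gP -mulmxA ggT mulmx1.
exists (exist _ g gTg); split=> //= [|e].
  apply: (can_inj (mulKmx u2)).
  by rewrite Py2 !mulmxA gP Py1 -mulmxA Pg.
by rewrite gE det_mulmx det_inv e mulVr // -unitmxE.
Qed.

Lemma so_form0 (K : numFieldType) n (y : so K n) (w : 'rV[K]_n) :
  w *m val y *m w^T = 0.
Proof.
have wyw : (w *m val y *m w^T)^T = - (w *m val y *m w^T).
  by rewrite !trmx_mul trmxK so_tr mulNmx mulmxN mulmxA.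
apply/matrixP=> i j; rewrite !ord1 [RHS]mxE; apply/eqP.
have /matrixP/(_ 0 0)/eqP := wyw.
by rewrite mxE [RHS in _ == RHS]mxE -addr_eq0 -mulr2n mulrn_eq0.
Qed.

Lemma coAd_straighten (K : numFieldType) n (lam : dualC K n) :
  (lam.2 *m lam.2^T) 0 0 != 0 ->
  exists2 h : IO K n, val h.1 = 1%:M
    & (coAd h lam).2 = lam.2 /\ lam.2 *m val (coAd h lam).1 = 0.
Proof.
case: lam => [y w] /= q0; have h1 : (1%:M : 'M[K]_n)^T *m 1%:M == 1%:M.
  by rewrite trmx1 mulmx1.
have := mx11_scalar (w *m w^T); move: ((w *m w^T) 0 0) q0 => q q0 wwT.
(* For a translation by u, w y becomes w y + (w u) w - q u^T. This u makes q u^T = w y, and w u = 0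
   because w y w^T = 0. *)
exists (exist _ 1%:M h1, - q^-1 *: (val y *m w^T)) => //=.
rewrite trmx1 !mulmx1 mul1mx; split=> //.
rewrite trmx_mul mulmxDr mulmxBr -scalemxAl -scalemxAr !mulmxA so_form0 mul0mx scaler0.
rewrite [(_ *: _)^T]linearZ /= trmx_mul trmxK so_tr mulmxN scaleNr scalerN opprK.
rewrite -scalemxAr wwT mul_scalar_mx scalerA mulVf ?scale1r //.
by rewrite sub0r subrr.
Qed.

Lemma Y_alg_orbit (K : numClosedFieldType) m (f : dualC K m.+1 -> K)
    (d : 'I_m -> K) (lam mu : dualC K m.+1) :
  Y_alg K m.+1 f -> odd m -> injective d ->
  (lam.2 *m lam.2^T) 0 0 != 0 -> lam.2 *m lam.2^T = mu.2 *m mu.2^T ->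
  (forall i, root (bordered_char (val lam.1) lam.2) (d i)) ->
  bordered_char (val lam.1) lam.2 = bordered_char (val mu.1) mu.2 ->
  f lam = f mu.
Proof.
move=> [_ finv] om dinj.
have finv' (h : IO K m.+1) nu : \det (val h.1) = 1 -> f (coAd h nu) = f nu.
  by move=> dh; apply: (finv h) => //; exact: coAdP.
wlog [lam0 mu0] : lam mu / lam.2 *m val lam.1 = 0 /\ mu.2 *m val mu.1 = 0.
  move=> IH q0 eq_q droot eqH.
  have [h h1 [hw hy]] := coAd_straighten q0.
  have [k k1 [kw ky]] := coAd_straighten (eq_ind _ (fun A : 'M_1 => A 0 0 != 0) q0 _ eq_q).
  rewrite -(finv' h lam) ?h1 ?det1 // -(finv' k mu) ?k1 ?det1 //.
  apply: (IH (coAd h lam) (coAd k mu)).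
  - by split; [rewrite hw | rewrite kw].
  - by rewrite hw.
  - by rewrite hw kw.
  - by move=> i; rewrite bordered_char_coAd.
  - by rewrite !bordered_char_coAd.
case: lam mu lam0 mu0 => [y w] [y' w'] /= wy wy' q0 eq_q droot eqH.
have [X [Xy Xw fX XX]] := eigen_normal_form erefl (so_tr y) wy q0 dinj droot.
have q0' : (w' *m w'^T) 0 0 != 0 by rewrite -eq_q.
have droot' i : root (bordered_char (val y') w') (d i) by rewrite -eqH.
have [X' [Xy' Xw' fX' XX']] := eigen_normal_form erefl (so_tr y') wy' q0' dinj droot'.
pose P (v : 'rV_m.+1) (Z : 'M_(m, m.+1)) : 'M[K]_m.+1 := col_mx v Z.
(* The row w completes the frame, as an eigenvector for the eigenvalue 0. *)
pose D : 'M[K]_m.+1 := diag_mx (row_mx 0 (\row_i d i) : 'rV_(1 + m)).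
have uP (v : 'rV_m.+1) (Z : 'M_(m, m.+1)) :
    (v *m v^T) 0 0 != 0 -> Z *m v^T = 0 -> row_free Z -> P v Z \in unitmx.
  by move=> v0 Zv fZ; rewrite -row_free_unit; exact: (col_mx_free v0 Zv fZ).
have PD (z : 'M_m.+1) (v : 'rV_m.+1) (Z : 'M_(m, m.+1)) : v *m z = 0 ->
    Z *m z = diag_mx (\row_i d i) *m Z -> P v Z *m z = D *m P v Z.
  move=> vz Zz; rewrite /P /D (mul_col_mx v Z z) vz Zz diag_mx_row.
  apply: (etrans _ (esym (@mul_block_col _ 1 m 1 m _ _ _ _ _ v Z))).
  by rewrite !mul0mx addr0 add0r raddf0 mul0mx.
have gram (v : 'rV_m.+1) (Z : 'M_(m, m.+1)) : Z *m v^T = 0 ->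
    P v Z *m (P v Z)^T = block_mx (v *m v^T) 0 0 (Z *m Z^T).
  move=> Zv; rewrite /P (tr_col_mx v Z).
  apply: (etrans (@mul_col_row _ 1 m _ 1 m v Z _ _)).
  by rewrite Zv -[v *m Z^T]trmxK trmx_mul trmxK Zv trmx0.
have detN v Z : \det (P v (- Z)) = - \det (P v Z).
  have -> : P v (- Z) = (block_mx 1%:M 0 0 (-1)%:M : 'M_(1 + m)) *m P v Z.
    apply: (etrans _ (esym (@mul_block_col _ 1 m 1 m _ _ _ _ _ v Z))).
    rewrite !mul0mx addr0 add0r mul1mx.
    by rewrite mul_scalar_mx scaleN1r.
  rewrite det_mulmx (@det_ublock _ 1 m 1%:M 0 (-1)%:M) det1 det_scalar.
  by rewrite -signr_odd om mul1r expr1 mulN1r.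
(* Equal Gram matrices give determinants equal up to sign. Passing to - X keeps the Gram matrix and,
   m being odd, flips the sign. *)
have [Z [Zy Zw fZ ZZ detZ]] : exists Z : 'M_(m, m.+1),
    [/\ Z *m val y = diag_mx (\row_i d i) *m Z, Z *m w^T = 0, row_free Z,
     Z *m Z^T = opposite_gram d & \det (P w Z) = \det (P w' X')].
  have : \det (P w X) ^+ 2 == \det (P w' X') ^+ 2.
    have sqP v Z : \det (P v Z) ^+ 2 = \det (P v Z *m (P v Z)^T).
      by rewrite det_mulmx det_tr expr2.
    by rewrite !sqP !gram // eq_q XX XX'.
  rewrite eqf_sqr => /orP[/eqP detX|/eqP detX]; first by exists X.
  exists (- X); split; rewrite ?mulNmx ?Xy ?mulmxN ?Xw ?oppr0 //.
  - by rewrite /row_free mxrank_opp.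
  - by rewrite raddfN /= mulmxN opprK.
  - by rewrite detN detX opprK.
have eq_gram : P w Z *m (P w Z)^T = P w' X' *m (P w' X')^T.
  by rewrite !gram // eq_q ZZ XX'.
have [g [gy gP gdet]] := orthogonal_conj (uP _ _ q0 Zw fZ) (uP _ _ q0' Xw' fX')
  eq_gram (PD _ _ _ wy Zy) (PD _ _ _ wy' Xy').
rewrite -(finv' (g, 0) (y, w)) ?gdet //; congr f; congr (_, _).
  by apply: val_inj; rewrite /= mul0mx trmx0 subrr addr0.
move: gP; rewrite /P (mul_col_mx w Z) => e; by have [] := @eq_col_mx _ 1 m _ _ _ _ _ e.
Qed.

(** * An affine section *)

Definition isoE (K : numClosedFieldType) m : 'M[K]_(m, m + m) :=
  row_mx 1%:M 'i%:M.

Definition isoF (K : numClosedFieldType) m : 'M[K]_(m, m + m) :=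
  row_mx 2^-1%:M (- ('i / 2))%:M.

(** The eigenvalues 0, ..., m - 1 have distinct squares, as the Vandermonde argument in
    [psi_coef_unit] requires. *)
Definition isoL (K : numClosedFieldType) m : 'M[K]_m :=
  diag_mx (\row_i (i : nat)%:R).

Lemma isoEE (K : numClosedFieldType) m : isoE K m *m (isoE K m)^T = 0.
Proof.
rewrite tr_row_mx mul_row_col !tr_scalar_mx -!scalar_mxM mul1r -expr2 sqrCi.
by rewrite -raddfD /= subrr raddf0.
Qed.

Lemma isoEF (K : numClosedFieldType) m : isoE K m *m (isoF K m)^T = 1%:M.
Proof.
rewrite tr_row_mx mul_row_col !tr_scalar_mx -!scalar_mxM mul1r mulrN mulrA -expr2 sqrCi.
by rewrite -raddfD /= mulN1r opprK -mulr2n -[_ *+ 2]mulr_natl mulfV ?pnatr_eq0.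
Qed.

Lemma isoFE (K : numClosedFieldType) m : isoF K m *m (isoE K m)^T = 1%:M.
Proof. by rewrite -[LHS]trmxK trmx_mul trmxK isoEF trmx1. Qed.

Lemma isoFF (K : numClosedFieldType) m : isoF K m *m (isoF K m)^T = 0.
Proof.
rewrite tr_row_mx mul_row_col !tr_scalar_mx -!scalar_mxM mulrNN mulrACA -['i * 'i]expr2 sqrCi.
by rewrite mulN1r -raddfD /= subrr raddf0.
Qed.

Lemma ysec_proof (K : numClosedFieldType) m :
  ((isoF K m)^T *m isoL K m *m isoE K m - (isoE K m)^T *m isoL K m *m isoF K m)^T
  == - ((isoF K m)^T *m isoL K m *m isoE K m - (isoE K m)^T *m isoL K m *m isoF K m).
Proof. by rewrite linearB /= !trmx_mul !trmxK tr_diag_mx opprB !mulmxA. Qed.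

Definition ysec (K : numClosedFieldType) m : so K (m + m) :=
  exist (fun y : 'M_(m + m) => y^T == - y) _ (ysec_proof K m).

Definition wsec (K : numClosedFieldType) m (q : 'rV[K]_m) : 'rV[K]_(m + m) :=
  const_mx 1 *m isoE K m + 2^-1 *: (q *m isoF K m).

(** Zero for odd j and i^j for even j, with value 1 at j = 0 even when i = 0. *)
Definition moment (K : numClosedFieldType) m j (i : 'I_m) : K :=
  2^-1 * ((i : nat)%:R ^+ j + (- (i : nat)%:R) ^+ j).

Lemma isoE_ysec (K : numClosedFieldType) m :
  isoE K m *m val (ysec K m) = isoL K m *m isoE K m.
Proof. by rewrite mulmxBr !mulmxA isoEF isoEE !mul0mx mul1mx subr0. Qed.

Lemma isoF_ysec (K : numClosedFieldType) m :
  isoF K m *m val (ysec K m) = - (isoL K m *m isoF K m).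
Proof. by rewrite mulmxBr !mulmxA isoFE isoFF !mul0mx mul1mx sub0r. Qed.

Lemma wsec_ysec (K : numClosedFieldType) m j (q : 'rV[K]_m) :
  wsec q *m val (ysec K m) ^+ j
  = (\row_i (i : nat)%:R ^+ j) *m isoE K m
    + 2^-1 *: ((\row_i (q 0 i * (- (i : nat)%:R) ^+ j)) *m isoF K m).
Proof.
elim: j => [|j IH].
  rewrite expr0 mulmx1 /wsec; congr (_ *m isoE K m + _ *: (_ *m isoF K m)).
    by apply/rowP=> i; rewrite !mxE.
  by apply/rowP=> i; rewrite !mxE mulr1.
rewrite exprSr -[_ * val _]/(_ *m val _) mulmxA IH mulmxDl -scalemxAl -!mulmxA.
rewrite isoE_ysec isoF_ysec mulmxN mulmxA -mulNmx mulmxA.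
congr (_ *m isoE K m + _ *: (_ *m isoF K m)).
  by apply/rowP=> i; rewrite mul_mx_diag !mxE exprSr.
by apply/rowP=> i; rewrite mul_mx_diag !mxE exprSr mulrA mulrN mulNr.
Qed.

(** Isotropy of both families leaves only the mixed products, and the e-part of w is fixed; hence a
    form quadratic in w becomes linear in q. *)
Lemma wsec_moment (K : numClosedFieldType) m j (q : 'rV[K]_m) :
  (wsec q *m val (ysec K m) ^+ j *m (wsec q)^T) 0 0 = \sum_i q 0 i * moment K j i.
Proof.
rewrite wsec_ysec /wsec [(_ + _)^T]linearD /= [(_ *: _)^T]linearZ /= !trmx_mul.
set E := isoE K m; set F := isoF K m.
have mul2 (a b c d : 'rV[K]_m) : (a *m E + b *m F) *m (E^T *m c^T + F^T *m d^T)
    = a *m d^T + b *m c^T.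
  rewrite mulmxDl !mulmxDr !mulmxA -[a *m E *m _]mulmxA -[a *m E *m _]mulmxA.
  rewrite -[b *m F *m _]mulmxA -[b *m F *m _]mulmxA isoEE isoEF isoFE isoFF.
  by rewrite !mulmx0 !mul0mx !mulmx1 add0r addr0.
rewrite [2^-1 *: (_ *m F)]scalemxAl [2^-1 *: (F^T *m _)]scalemxAr -[2^-1 *: q^T]linearZ /= mul2.
rewrite mxE [X in X + _]mxE [X in _ + X]mxE -big_split; apply: eq_bigr => i _ /=.
rewrite !mxE /moment mulr1 mulrDr mulrDr; congr (_ + _); last by rewrite mulrCA.
by rewrite mulrC -mulrA mulrCA.
Qed.

Definition psi_coef (K : numClosedFieldType) m : 'M[K]_m :=
  \matrix_(i, k) - (moment K (2 * k) i -
    \sum_(1 <= j < (2 * k).+1) p_ j (val (ysec K m)) * moment K (2 * k - j) i).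

Lemma psi_sec (K : numClosedFieldType) m (q : 'rV[K]_m) (k : 'I_m) :
  psi k (ysec K m, wsec q) = (q *m psi_coef K m) 0 k.
Proof.
rewrite /psi /B_ /= mulmxBr mulmxBl mulmx_sumr mulmx_suml mxE [X in _ + X]mxE summxE.
rewrite wsec_moment [RHS]mxE.
under [RHS]eq_bigr => i _ do rewrite mxE mulrN mulrBr mulr_sumr.
rewrite [RHS]sumrN; congr (- _); rewrite sumrB; congr (_ - _).
rewrite [RHS]exchange_big /=; apply: eq_bigr => j _.
rewrite -scalemxAr -scalemxAl mxE wsec_moment mulr_sumr.
by apply: eq_bigr => i _; rewrite mulrCA.
Qed.

(** If q kills every psi_k, induction on j removes the lower terms of [B_] and shows that all
    moments of q below 2m vanish. The even ones form a Vandermonde system in the squares i^2. *)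
Lemma psi_coef_unit (K : numClosedFieldType) m : psi_coef K m \in unitmx.
Proof.
rewrite -row_free_unit; apply: inj_row_free => q qC.
have mom0 j : (j < 2 * m)%N -> \sum_i q 0 i * moment K j i = 0.
  elim/ltn_ind: j => j IH jm; have [oj|ej] := boolP (odd j).
    rewrite big1 // => i _; rewrite /moment exprNn -signr_odd oj expr1 mulN1r subrr.
    by rewrite !mulr0.
  have km : (j./2 < m)%N by lia.
  have jE : (2 * Ordinal km)%N = j by rewrite /=; lia.
  have := psi_sec q (Ordinal km); rewrite qC [RHS]mxE /psi /B_ jE mulmxBr mulmxBl.
  rewrite mulmx_sumr mulmx_suml mxE [X in _ + X]mxE summxE wsec_moment => /eqP.
  rewrite oppr_eq0 [X in _ - X]big_nat [X in _ - X]big1 ?subr0 => [/eqP //|i /andP[i1 ij]].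
  by rewrite -scalemxAr -scalemxAl mxE wsec_moment IH ?mulr0 //; lia.
pose V := Vandermonde m (\row_(i < m) (i%:R ^+ 2 : K)).
have uV : V \in unitmx.
  rewrite unitmxE unitfE det_Vandermonde; apply/prodf_neq0 => i _.
  apply/prodf_neq0 => j ij; rewrite !mxE subr_eq0 -!natrX eqr_nat eqn_exp2r //.
  by rewrite neq_ltn ij orbT.
apply: (can_inj (mulmxK (_ : V^T \in unitmx))); rewrite ?unitmx_tr // mul0mx.
apply/rowP=> k; rewrite !mxE -[RHS](mom0 (2 * k)%N) ?ltn_pmul2l //.
apply: eq_bigr => i _; rewrite !mxE /moment exprNn -signr_odd oddM /= mul1r.
by rewrite -exprM -mulr2n -[_ ^+ _ *+ 2]mulr_natl mulKf ?pnatr_eq0.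
Qed.

Definition section (K : numClosedFieldType) m (t : 'rV[K]_m) : dualC K (m + m) :=
  (ysec K m, wsec (t *m invmx (psi_coef K m))).

Lemma psi_section (K : numClosedFieldType) m (t : 'rV[K]_m) (k : 'I_m) :
  psi k (section t) = t 0 k.
Proof. by rewrite psi_sec mulmxKV ?psi_coef_unit. Qed.

Lemma polyfun_section (K : numClosedFieldType) m (f : dualC K (m + m) -> K) :
  polyfun f -> exists P : {mpoly K[m]}, forall t, f (section t) = P.@[fun k => t 0 k].
Proof.
case=> p fp; pose C := map_mx (@mpolyC m K).
pose z : 'rV_((m + m) * (m + m) + (m + m)) :=
  row_mx (C _ _ (mxvec (val (ysec K m))))
    (C _ _ (const_mx 1 *m isoE K m)
     + (\row_k 'X_k) *m C _ _ (2^-1 *: (invmx (psi_coef K m) *m isoF K m))).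
exists (p \mPo [tuple z 0 i | i < _]) => t.
rewrite fp comp_mpoly_meval; apply: meval_eq => i; rewrite tnth_mktuple.
pose v (k : 'I_m) := t 0 k; have -> : (z 0 i).@[v] = map_mx (meval v) z 0 i by rewrite [RHS]mxE.
congr (fun_of_matrix _ 0 i).
have CK k j (A : 'M[K]_(k, j)) : map_mx (meval v) (C _ _ A) = A.
  by apply/matrixP=> a b; rewrite !mxE mevalC.
rewrite /z map_row_mx map_mxD map_mxM !CK; congr row_mx.
rewrite /section /wsec /=; congr (_ + _); rewrite -mulmxA scalemxAr.
by congr (_ *m _); apply/rowP=> k; rewrite !mxE mevalXU.
Qed.

(** * Density of the regular points *)

(** By [lead_bordered_char], the first condition also gives the bordered polynomial full degree n -
    1. *)
Definition regular (K : fieldType) n (lam : dualC K n) : bool :=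
  ((lam.2 *m lam.2^T) 0 0 != 0) && separable_poly (bordered_char (val lam.1) lam.2).

Lemma size_bordered_char (K : numFieldType) n (y : 'M[K]_n) (w : 'rV[K]_n) :
  (size (bordered_char y w) <= n)%N.
Proof. by rewrite bordered_charE size_poly. Qed.

Lemma lead_bordered_char (K : numFieldType) n (y : 'M[K]_n) (w : 'rV[K]_n) :
  (0 < n)%N -> (bordered_char y w)`_n.-1 = - (w *m w^T) 0 0.
Proof.
by move=> n0; rewrite bordered_charE coef_poly prednK // leqnn subnn B_0 mulmx1.
Qed.

Lemma Y_alg_regular (K : numClosedFieldType) n (f : dualC K n -> K) lam mu :
  Y_alg K n f -> ~~ odd n -> regular lam ->
  bordered_char (val lam.1) lam.2 = bordered_char (val mu.1) mu.2 -> f lam = f mu.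
Proof.
case: n => [|m] in f lam mu *.
  by move=> _ _ /andP[/negP[]]; rewrite mxE big_ord0.
move=> Yf /negPn om /andP[q0 sep] eqH.
set H := bordered_char _ _ in sep *.
have szH : size H = m.+1.
  apply/anti_leq; rewrite size_bordered_char ltnNge; apply: contra q0 => szH.
  by rewrite -oppr_eq0 -(lead_bordered_char (val lam.1)) // nth_default.
have [r rE] := closed_field_poly_normal H.
have lc0 : lead_coef H != 0 by rewrite lead_coef_eq0 -size_poly_eq0 szH.
have szr : size r = m.
  by have := szH; rewrite rE size_scale // size_prod_XsubC => -[].
have ur : uniq r.
  by rewrite -separable_prod_XsubC -(eqp_separable (eqp_scale _ lc0)) -rE.
apply: (Y_alg_orbit (d := fun i : 'I_m => r`_i) Yf om) => //.
- by move=> i j /eqP; rewrite nth_uniq ?szr // => /eqP/val_inj.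
(* The scalar w w^T is read off the leading coefficient. *)
- have lE := lead_bordered_char (val lam.1) lam.2 (ltn0Sn m).
  have mE := lead_bordered_char (val mu.1) mu.2 (ltn0Sn m).
  by apply/matrixP=> i j; rewrite !ord1; apply: oppr_inj; rewrite -lE -mE eqH.
- by move=> i; rewrite -/H rE rootZ // root_prod_XsubC mem_nth ?szr.
Qed.

Lemma exists_regular (K : numClosedFieldType) l :
  exists lam : dualC K (l.+1 + l.+1), regular lam.
Proof.
(* Only psi_0 and psi_l are nonzero, so H = X^(2l+1) + X; for l = 0 the two terms merge into 2X. *)
pose t : 'rV[K]_l.+1 := \row_k ((k == ord0)%:R + (k == ord_max)%:R).
have nE : (l.+1 + l.+1 = 2 * l + 2)%N by lia.
have HE := bordered_char_psi (section t) nE.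
have {}HE : bordered_char (val (section t).1) (section t).2 = 'X^((2 * l).+1) + 'X.
  rewrite HE; under eq_bigr => k _ do rewrite psi_section mxE scalerDl.
  rewrite big_split /= (bigD1 ord0) //= big1 => [|k /negPf->]; last exact: scale0r.
  rewrite (bigD1 ord_max) //= big1 => [|k /negPf->]; last exact: scale0r.
  rewrite ?eqxx !scale1r !addr0 -[X in _ = _ + X]expr1; by congr (_ + _); congr (_ ^+ _); lia.
exists (section t); rewrite /regular HE; apply/andP; split.
  rewrite -oppr_eq0 -(lead_bordered_char (val (section t).1)) // HE coefD coefXn coefX.
  have -> : ((l.+1 + l.+1).-1 = (2 * l).+1)%N by lia.
  rewrite eqxx.
  by rewrite -natrD pnatr_eq0.
rewrite unlock /separable_poly; apply/Pdiv.ClosedField.root_coprimep => x.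
rewrite derivD derivXn derivX /root !hornerE hornerMn hornerXn => /eqP x0.
apply/eqP => x1; have [l0|l0] := posnP l.
  by move: x1; rewrite l0 muln0 expr0 mulr1n -mulr2n => /eqP; rewrite pnatr_eq0.
have xE : x ^+ (2 * l).+1 = - x by apply/eqP; rewrite -addr_eq0 x0.
(* Multiplying H'(x) = 0 by x and using x^(2l+1) = - x gives 2l x = 0, so x = 0; but H'(0) = 1. *)
have : x * (x ^+ (2 * l) *+ (2 * l).+1 + 1) = 0 by rewrite x1 mulr0.
rewrite mulrDr mulr1 mulrnAr -exprS xE mulNrn mulrS opprD addrAC addNr add0r => /eqP.
rewrite oppr_eq0 mulrn_eq0 muln_eq0 -[l == 0%N]negbK -lt0n l0 /= => /eqP x00.
move: x1; rewrite x00 expr0n muln_eq0 -[l == 0%N]negbK -lt0n l0 /= mul0rn add0r.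
by move/eqP; rewrite oner_eq0.
Qed.

(** * Restriction to lines and genericity *)

Lemma line_proof (K : fieldType) n (y z : so K n) s :
  (val y + s *: (val z - val y))^T == - (val y + s *: (val z - val y)).
Proof.
rewrite [(_ + _)^T]linearD /= [(_ *: _)^T]linearZ /= [(_ - _)^T]linearB /= !so_tr.
by rewrite -opprD scalerN -opprD.
Qed.

Definition line (K : fieldType) n (lam mu : dualC K n) s : dualC K n :=
  (exist (fun y : 'M_n => y^T == - y) _ (line_proof lam.1 mu.1 s),
   lam.2 + s *: (mu.2 - lam.2)).

Lemma line0 (K : fieldType) n (lam mu : dualC K n) : line lam mu 0 = lam.
Proof.
case: lam mu => [y w] [z v]; congr (_, _); last by rewrite scale0r addr0.
by apply: val_inj; rewrite /= scale0r addr0.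
Qed.

Lemma line1 (K : fieldType) n (lam mu : dualC K n) : line lam mu 1 = mu.
Proof.
case: lam mu => [y w] [z v]; congr (_, _); last by rewrite scale1r addrC subrK.
by apply: val_inj; rewrite /= scale1r addrC subrK.
Qed.

Lemma horner_mmap (K : fieldType) N (p : {mpoly K[N]}) (v : 'I_N -> {poly K}) s :
  (mmap polyC v p).[s] = p.@[fun i => (v i).[s]].
Proof.
rewrite /meval /mmap horner_sum; apply: eq_bigr => m _.
rewrite hornerM hornerC /mmap1 horner_prod; congr (_ * _).
by apply: eq_bigr => i _; rewrite horner_exp.
Qed.

Lemma map_horner_line (K : fieldType) k n (A B : 'M[K]_(k, n)) s :
  map_mx (horner_eval s) (map_mx polyC A + 'X *: map_mx polyC (B - A))
  = A + s *: (B - A).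
Proof.
by apply/matrixP=> i j; rewrite !mxE horner_evalE hornerD hornerM hornerX !hornerC.
Qed.

Lemma polyfun_line (K : fieldType) n (f : dualC K n -> K) lam mu :
  polyfun f -> exists q : {poly K}, forall s, f (line lam mu s) = q.[s].
Proof.
case=> p fp.
pose z (A B : 'rV[K]_(n * n + n)) := map_mx polyC A + 'X *: map_mx polyC (B - A).
pose v (nu : dualC K n) := row_mx (mxvec (val nu.1)) nu.2.
exists (mmap polyC (fun i => z (v lam) (v mu) 0 i) p) => s.
rewrite fp horner_mmap; apply: meval_eq => i.
transitivity ((v lam + s *: (v mu - v lam)) 0 i).
  congr (fun_of_matrix _ 0 i); rewrite /v opp_row_mx add_row_mx scale_row_mx add_row_mx /=.
  by rewrite linearD /= linearZ /= linearB.
by rewrite -map_horner_line mxE.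
Qed.

Lemma polyfun_regular_eq0 (K : numFieldType) n (f : dualC K n -> K)
    (mu : dualC K n) :
  polyfun f -> (1 < n)%N -> regular mu -> (forall lam, regular lam -> f lam = 0) ->
  forall lam, f lam = 0.
Proof.
move=> pf n1 rmu f0 lam; have [q fq] := polyfun_line lam mu pf.
pose L k (A B : 'M[K]_(k, n)) := map_mx polyC A + 'X *: map_mx polyC (B - A).
pose H := bordered_char (L _ (val lam.1) (val mu.1)) (L _ lam.2 mu.2).
have Hs s : map_poly (horner_eval s) H
    = bordered_char (val (line lam mu s).1) (line lam mu s).2.
  by rewrite map_bordered_char !map_horner_line.
pose c := H`_n.-1; pose r := resultant H H^`().
have cs s : c.[s] = - ((line lam mu s).2 *m (line lam mu s).2^T) 0 0.
  by rewrite -(lead_bordered_char (val (line lam mu s).1)) -?Hs ?coef_map //; lia.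
(* The coefficients of H lie in [{poly K}], not in a field, so the degree bound is obtained from
   every specialisation of s. *)
have szH : (size H <= n)%N.
  apply/leq_sizeP => j nj; apply: poly_horner_inj => s.
  rewrite horner0 -[LHS]/(horner_eval s _) -coef_map /= Hs nth_default //.
  exact: leq_trans (size_bordered_char _ _) nj.
(* The resultant commutes with specialisation when the leading coefficients c and (n - 1) c of H and
   its derivative survive at s. *)
have rs s : c.[s] != 0 ->
    (r.[s] != 0) = separable_poly (bordered_char (val (line lam mu s).1) (line lam mu s).2).
  move=> cs0; have lead (p : {poly {poly K}}) k :
      (size p <= k.+1)%N -> (p`_k).[s] != 0 -> lead_coef p = p`_k.
    move=> szp pk; rewrite lead_coefE; congr (p`_ _).
    suff -> : size p = k.+1 by [].
    apply/anti_leq; rewrite szp ltnNge; apply: contra pk => szp'.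
    by rewrite nth_default // horner0.
  have lH : lead_coef H = c by apply: lead; rewrite // prednK //; lia.
  have dc : H^`()`_n.-2 = c *+ n.-1.
    by rewrite coef_deriv (_ : n.-2.+1 = n.-1) //; lia.
  have dcs : (c *+ n.-1).[s] != 0 by rewrite hornerMn mulrn_eq0 (negPf cs0) orbF; lia.
  have lH' : lead_coef H^`() = c *+ n.-1.
    rewrite -dc; apply: lead; last by rewrite dc.
    by apply: leq_trans (size_poly _ _) _; lia.
  rewrite -[r.[s]]/(horner_eval s _) map_resultant ?lH ?lH' //= -deriv_map Hs.
  have Hs0 : bordered_char (val (line lam mu s).1) (line lam mu s).2 != 0.
    apply: contraNneq cs0 => Hs0; rewrite -[c.[s]]/(horner_eval s _) -coef_map /= Hs Hs0.
    by rewrite coef0.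
  rewrite resultant_eq0 unlock /separable_poly /coprimep -leqNgt eqn_leq.
  by rewrite size_poly_gt0 gcdp_eq0 (negPf Hs0) andbT.
have reg1 : regular (line lam mu 1) by rewrite line1.
have cr0 : c * r != 0.
  have /andP[q1 s1] := reg1.
  have c1 : c.[1] != 0 by rewrite cs oppr_eq0.
  apply: contraTneq s1 => cr; rewrite -rs // negbK.
  have := congr1 (horner^~ 1) cr; rewrite hornerM horner0 => /eqP.
  by rewrite mulf_eq0 (negPf c1).
have q0 : q = 0.
  apply: (poly_generic_eq0 cr0) => s; rewrite hornerM mulf_eq0 negb_or => /andP[c0 r0].
  rewrite -fq; apply: f0; rewrite /regular -rs // r0 andbT.
  by rewrite -oppr_eq0 -cs.
by rewrite -(line0 lam mu) fq q0 horner0.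
Qed.

(** * Equality of the three algebras by a cycle of inclusions *)

Theorem mainTheorem2 (R : realType) (l n : nat) (hn : n = (2 * l + 2)%N) :
  J_alg R[i] n = Y_alg R[i] n /\
  J_alg R[i] n = generated_alg (fun k : 'I_l.+1 => @psi R[i] n k).
Proof.
have {hn} nE : n = (l.+1 + l.+1)%N by lia.
subst n; pose n := (l.+1 + l.+1)%N.
have JY : (J_alg R[i] n `<=` Y_alg R[i] n)%classic.
  by move=> f [pf finv]; split=> // h lam mu _; apply: finv.
have YG : (Y_alg R[i] n `<=` generated_alg (fun k : 'I_l.+1 => @psi R[i] n k))%classic.
  (* The candidate P is the restriction of f to the section, written in the values of psi. *)
  move=> f Yf; have [P fP] := polyfun_section Yf.1; exists P => lam.
  have [mu rmu] := exists_regular R[i] l.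
  have GJ : J_alg R[i] n (fun lam : dualC R[i] n => P.@[fun k : 'I_l.+1 => psi k lam]).
    by apply: (@generated_sub_J _ _ l); [rewrite /n; lia | exists P].
  (* As f - P(psi) is a polynomial function, its vanishing at regular points suffices. *)
  apply/subr0_eq; move: lam; apply: (polyfun_regular_eq0 (mu := mu)) => //.
  - have [[p fp] [q Pq]] := (Yf.1, GJ.1); exists (p - q) => lam.
    by rewrite mevalB -fp -Pq.
  - by rewrite /n; lia.
  move=> lam rlam; pose t := \row_(k < l.+1) psi k lam.
  (* The section point with the same psi has the same bordered polynomial, so f agrees there with
     its value at [lam]. *)
  rewrite (Y_alg_regular (mu := section t) Yf _ rlam).
  - by rewrite fP; apply/eqP; rewrite subr_eq0; apply/eqP/meval_eq => k; rewrite mxE.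
  - by rewrite addnn odd_double.
  rewrite !(@bordered_char_psi _ _ l) /n; [|lia..].
  by apply: eq_bigr => k _; rewrite psi_section mxE.
have GJ := @generated_sub_J R[i] n l (ltac:(rewrite /n; lia)).
split; apply/seteqP; split=> //.
- by move=> f /YG/GJ.
- by move=> f /JY/YG.
Qed.
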